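(* Let $g:H\to H'$ and $q:H\to H$ satisfy assumptions (A1)–(A4) of the context with constants $\sigma_1,\kappa_0,\kappa_1$. Let $x_0\in H$ and let $(x_k)_{k\ge 0}$ be generated by NGMRES with depth $m=0$, i.e. at step $k+1$, $\alpha^{k+1}\in\mathbb{R}$ is a minimizer of $$\alpha\mapsto\left\|\alpha\, g(q(x_k))+(1-\alpha)\,g(x_k)\right\|_{H'},\qquad\text{and}\qquad x_{k+1}=\alpha^{k+1}q(x_k)+(1-\alpha^{k+1})x_k .$$ Assume there is $\bar\alpha>0$ such that $|\alpha^{k+1}|+|1-\alpha^{k+1}|\le\bar\alpha$ at every step. Set $$\theta^0_{k+1}=\frac{\|\alpha^{k+1}g(q(x_k))+(1-\alpha^{k+1})g(x_k)\|_{H'}}{\|g(x_k)\|_{H'}},\qquad \gamma^0_{k+1}=\frac{\|\alpha^{k+1}g(q(x_k))+(1-\alpha^{k+1})g(x_k)\|_{H'}}{\|g(q(x_k))\|_{H'}} .$$ Then the iterate $x_{k+1}$ satisfies $$\|g(x_{k+1})\|_{H'}\le\theta^0_{k+1}\|g(x_k)\|_{H'}+\mathcal{O}(\|g(x_k)\|_{H'}^2),$$ $$\|g(x_{k+1})\|_{H'}\le\gamma^0_{k+1}\,\kappa_1\,\|g(x_k)\|_{H'}+\mathcal{O}(\|g(x_k)\|_{H'}^2).$$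
   Context: $(H,\|\cdot\|_H)$ is a Hilbert space and $H'$ its dual, with the dual norm $\|y\|_{H'}=\sup_{0\ne x\in H}\langle y,x\rangle/\|x\|_H$. Assumptions on $g:H\to H'$ and $q:H\to H$: (A1) There is $x^*\in H$ with $g(x^* )=0$ and $q(x^* )=x^*$. (A2) $g$ is Fréchet differentiable on $H$, with derivative at $x$ in direction $h$ denoted $g'(x;h)\in H'$ (linear in $h$), and there is $\sigma_1>0$ with $\|g'(x;h)-g'(y;h)\|_{H'}\le\sigma_1\|x-y\|_H\|h\|_H$ for all $x,y,h\in H$. (A3) $q$ is continuous and there is $\kappa_0>0$ with $\|q(x)-x\|_H\le\kappa_0\|g(x)\|_{H'}$ for all $x\in H$. (A4) There is $\kappa_1>0$ with $\|g(q(x))\|_{H'}\le\kappa_1\|g(x)\|_{H'}$ for all $x\in H$. $q$ is not assumed to be contractive, and $\kappa_1$ may be larger than $1$. The quantities $\theta^0_{k+1}$ and $\gamma^0_{k+1}$ are understood to be defined when their denominators are nonzero. *)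

(* Defs.v *)
From HB Require Import structures.
From mathcomp Require Import all_boot all_order all_algebra.
From mathcomp Require Import all_classical all_reals all_analysis.

Set Implicit Arguments.
Unset Strict Implicit.
Unset Printing Implicit Defensive.

Import Order.TTheory GRing.Theory Num.Theory.
Import numFieldNormedType.Exports.

Local Open Scope classical_set_scope.
Local Open Scope ring_scope.

Definition is_functional (R : realType) (V : normedModType R) : pred (V -> R^o) :=
  fun f => `[< linear f /\ continuous f >].

Record dual (R : realType) (V : normedModType R) := Dual {
  dual_fun :> V -> R^o;
  dualP : dual_fun \in @is_functional R V }.

HB.instance Definition _ (R : realType) (V : normedModType R) :=
  [isSub for @dual_fun R V].
HB.instance Definition _ (R : realType) (V : normedModType R) :=
  [Choice of dual V by <:].

Lemma is_functional_submod (R : realType) (V : normedModType R) :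
  submod_closed (@is_functional R V).
Proof.
split.
  apply/asboolP; split; last exact: cst_continuous.
  by move=> a x y /=; rewrite scaler0 addr0.
move=> a f g /asboolP[fl fc] /asboolP[gl gc]; apply/asboolP; split.
  move=> b x y; rewrite !addrfctE !scalrfctE fl gl !scalerDr !scalerA.
  by rewrite (mulrC a b) addrACA.
move=> x; apply: (@continuousD R R^o V); last exact: gc.
by apply: (@continuousZl_tmp R R^o V); exact: fc.
Qed.

HB.instance Definition _ (R : realType) (V : normedModType R) :=
  GRing.isSubmodClosed.Build R _ (@is_functional R V)
    (@is_functional_submod R V).
HB.instance Definition _ (R : realType) (V : normedModType R) :=
  [SubChoice_isSubLmodule of dual V by <:].

Section dual_norm.
Variables (R : realType) (V : normedModType R).
Implicit Types (f g : dual V) (x : V).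

Definition dual_norm f : R :=
  sup [set f x / `|x| | x in [set x : V | x != 0]].

Lemma dual_linear f : linear f.
Proof. by have /asboolP[] := dualP f. Qed.

Lemma dual_continuous f : continuous f.
Proof. by have /asboolP[] := dualP f. Qed.

HB.instance Definition _ f :=
  GRing.isLinear.Build R V R^o *:%R f (dual_linear f).

Lemma dualDE f g x : (f + g) x = f x + g x.
Proof. by []. Qed.

Lemma dualZE a f x : (a *: f) x = a * f x.
Proof. by []. Qed.

Lemma dual_ratios_bounded f :
  has_ubound [set f x / `|x| | x in [set x : V | x != 0]].
Proof.
have /linear_bounded_continuous /linear_boundedP /pinfty_ex_gt0[M M0 fM] :=
  @dual_continuous f.
exists M => _ [x /= x0 <-]; rewrite ler_pdivrMr ?normr_gt0//.
exact: le_trans (ler_norm _) (fM x).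
Qed.

Lemma dual_norm_ge f x : `|f x| <= dual_norm f * `|x|.
Proof.
have H y : f y <= dual_norm f * `|y|.
  have [->|y0] := eqVneq y 0; first by rewrite raddf0 normr0 mulr0.
  rewrite -ler_pdivrMr ?normr_gt0//; apply: ub_le_sup; last by exists y.
  exact: dual_ratios_bounded.
by rewrite ler_norml H andbT lerNl -raddfN (le_trans (H _))// normrN.
Qed.

Lemma dual_norm_le f (M : R) : 0 <= M ->
  (forall x, `|f x| <= M * `|x|) -> dual_norm f <= M.
Proof.
move=> M0 fM; rewrite /dual_norm; set A := (X in sup X).
have [->|A0] := eqVneq A set0; first by rewrite sup0.
apply: ge_sup; first exact/set0P.
move=> _ [x /= x0 <-]; rewrite ler_pdivrMr ?normr_gt0//.
exact: le_trans (ler_norm _) (fM x).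
Qed.

Lemma dual_norm_ge0 f : 0 <= dual_norm f.
Proof.
rewrite /dual_norm; set A := (X in sup X).
have [->|/set0P[_ [x /= x0 _]]] := eqVneq A set0; first by rewrite sup0.
by rewrite -(pmulr_lge0 _ (_ : 0 < `|x|)) ?normr_gt0//
  (le_trans _ (dual_norm_ge f x)).
Qed.

Lemma dual_normD f g : dual_norm (f + g) <= dual_norm f + dual_norm g.
Proof.
apply: dual_norm_le => [|x]; first by rewrite addr_ge0 ?dual_norm_ge0.
by rewrite dualDE mulrDl (le_trans (ler_normD _ _))// lerD ?dual_norm_ge.
Qed.

Let dual_normZ_le a f : dual_norm (a *: f) <= `|a| * dual_norm f.
Proof.
apply: dual_norm_le => [|x]; first by rewrite mulr_ge0 ?dual_norm_ge0.
by rewrite dualZE normrM -mulrA ler_wpM2l ?dual_norm_ge.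
Qed.

Lemma dual_normZ a f : dual_norm (a *: f) = `|a| * dual_norm f.
Proof.
apply/eqP; rewrite eq_le dual_normZ_le /=.
have [->|a0] := eqVneq a 0; first by rewrite normr0 mul0r dual_norm_ge0.
rewrite -ler_pdivlMl ?normr_gt0// -normfV.
by rewrite (le_trans _ (dual_normZ_le _ _))// scalerA mulVf// scale1r.
Qed.

Lemma dual_norm0_eq0 f : dual_norm f = 0 -> f = 0.
Proof.
move=> f0; apply/val_inj/funext => x /=; apply/eqP.
by rewrite -normr_le0 (le_trans (dual_norm_ge f x))// f0 mul0r.
Qed.

HB.instance Definition _ :=
  Lmodule_isNormed.Build R (dual V) dual_normD dual_normZ dual_norm0_eq0.

End dual_norm.

Lemma dual_normE (R : realType) (V : normedModType R) (f : dual V) :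
  `|f| = sup [set f x / `|x| | x in [set x : V | x != 0]].
Proof. by []. Qed.

(* Makes [H] with its own norm a Hilbert space: the norm of the complete space
   [H] is the one induced by [ip]. *)
Definition hilbert_norm (R : realType) (H : completeNormedModType R)
  (ip : {dot H for idfun}) := forall x : H, `|x| ^+ 2 = ip x x.

Section ngmres.
Variables (R : realType) (H : completeNormedModType R).
Variables (g : H -> dual H) (q : H -> H).

Definition has_common_solution := exists xs : H, g xs = 0 /\ q xs = xs.

Definition lipschitz_diff (sigma1 : R) :=
  (forall x : H, differentiable g x) /\
  (forall x y h : H, `|'d g x h - 'd g y h| <= sigma1 * `|x - y| * `|h|).

Definition residual_controls_step (kappa0 : R) :=
  continuous q /\ (forall x : H, `|q x - x| <= kappa0 * `|g x|).

Definition residual_bounded_by (kappa1 : R) :=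
  forall x : H, `|g (q x)| <= kappa1 * `|g x|.

Definition mixed_residual (a : R) (x : H) : dual H :=
  a *: g (q x) + (1 - a) *: g x.

(* [alpha k.+1] is the mixing parameter used to compute [x k.+1];
   [alpha 0] is irrelevant. *)
Definition ngmres0 (alpha : nat -> R) (x : nat -> H) :=
  forall k : nat,
    (forall b : R,
       `|mixed_residual (alpha k.+1) (x k)| <= `|mixed_residual b (x k)|) /\
    x k.+1 = alpha k.+1 *: q (x k) + (1 - alpha k.+1) *: x k.

Definition theta0 (a : R) (x : H) : R := `|mixed_residual a x| / `|g x|.

Definition gamma0 (a : R) (x : H) : R := `|mixed_residual a x| / `|g (q x)|.

End ngmres.

(* Main.v *)
(** With [d = q x - x], expanding [g] to first order at [x] turns
    [g (x + a d) - (a g (x + d) + (1 - a) g x)] into a combination of two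
    linearization errors. These are [O(|d|^2)] because [g'] is Lipschitz,
    hence [O(|g x|^2)] because [|d| <= kappa0 |g x|]. *)

Require Import Defs.
From mathcomp Require Import all_boot all_order all_algebra.
From mathcomp Require Import all_classical all_reals all_analysis.

Import Order.TTheory GRing.Theory Num.Theory.
Import numFieldNormedType.Exports.

Local Open Scope classical_set_scope.
Local Open Scope ring_scope.

(** Evaluation at [w] is Lipschitz for the dual norm, with constant the norm of [w]. This lets
    limits in the dual pass to scalar values. *)
Lemma dual_eval_continuous (R : realType) (V : normedModType R) (w : V) :
  continuous (fun f : dual V => f w : R^o).
Proof.
move=> f; apply/(@cvgrPdist_le _ _ _ _ (nbhs_filter f)) => e e0.
(* The added [1] keeps the radius meaningful when [w = 0]. *)
have w0 : 0 < 1 + `|w| by rewrite ltr_pwDl.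
apply: filterS (nbhsx_ballx f _ (divr_gt0 e0 w0)) => h.
rewrite -ball_normE /= => /ltW fh.
rewrite -[f w - h w]/((f - h) w) (le_trans (dual_norm_ge _ _))//.
rewrite (@le_trans _ _ (`|f - h| * (1 + `|w|)))//; last by rewrite -ler_pdivlMr.
by rewrite ler_wpM2l ?dual_norm_ge0// lerDr.
Qed.

(** Evaluation at [w] is linear and continuous, so it commutes with the limit of the difference
    quotients of [g] in direction [v]. *)
Lemma is_derive_dual_line (R : realType) (V : normedModType R)
    (g : V -> dual V) (x v w : V) (t : R) :
  differentiable g (x + t *: v) ->
  is_derive t 1 (fun s : R => g (x + s *: v) w : R^o)
    ('d g (x + t *: v) v w).
Proof.
move=> dg.
have -> : 'd g (x + t *: v) v = 'D_v g (x + t *: v) by rewrite deriveE.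
have /(continuous_cvg _ (@dual_eval_continuous R V w _)) :=
  @diff_derivable _ _ _ g _ v dg.
set F := (X in X @ _) => cF.
have FE : F = fun h : R => h^-1 *:
    (((fun s : R => g (x + s *: v) w : R^o) \o shift t) (h *: (1 : R^o))
     - g (x + t *: v) w).
  apply/funext => h; rewrite /F /= [h *: (1 : R^o)]mulr1.
  by rewrite scalerDl addrCA.
rewrite FE in cF.
apply: DeriveDef; first by apply/cvg_ex; eexists; exact: cF.
exact: cvg_lim cF.
Qed.

(* The mean value theorem is available for scalar functions only, so it is
   applied to [t |-> g (x + t v) w] for each direction [w]. *)
Lemma linearization_error (R : realType) (H : completeNormedModType R)
    (g : H -> dual H) (sigma : R) (x v : H) :
  0 <= sigma -> lipschitz_diff g sigma ->
  `|g (x + v) - g x - 'd g x v| <= sigma * `|v| ^+ 2.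
Proof.
move=> sigma0 [dg lip].
apply: dual_norm_le => [|w]; first by rewrite mulr_ge0 ?exprn_ge0.
have D t := @is_derive_dual_line R H g x v w t (dg _).
have cont : {within `[0, 1], continuous (fun t : R => g (x + t *: v) w : R^o)}.
  by apply: derivable_within_continuous => t _; apply: ex_derive.
have [c /[!in_itv]/= /andP[c0 c1]] :=
  @MVT_segment R _ (fun t => 'd g (x + t *: v) v w) 0 1 ler01
    (fun t _ => D t) cont.
rewrite scale1r scale0r addr0 subr0 mulr1 => E.
rewrite -[_ w]/(g (x + v) w - g x w - 'd g x v w) E.
rewrite -[_ - _]/(('d g (x + c *: v) v - 'd g x v) w).
rewrite (le_trans (dual_norm_ge _ _))// ler_wpM2r//.
(* The intermediate point [c] depends on [w], but only [c <= 1] is used, so the bound is uniform in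
   [w]; the price is [sigma] instead of the sharp [sigma / 2]. *)
rewrite (le_trans (lip _ _ _))// addrAC subrr add0r normrZ (ger0_norm c0).
rewrite -mulrA ler_wpM2l// expr2 -mulrA ler_piMl// mulr_ge0.
Qed.

Lemma mixed_residual_error (R : realType) (H : completeNormedModType R)
    (g : H -> dual H) (q : H -> H) (sigma kappa0 abar a : R) (x : H) :
  0 <= sigma ->
  lipschitz_diff g sigma -> residual_controls_step g q kappa0 ->
  `|a| <= abar ->
  `|g (a *: q x + (1 - a) *: x)| <=
  `|mixed_residual g q a x| +
  sigma * (abar ^+ 2 + abar) * kappa0 ^+ 2 * `|g x| ^+ 2.
Proof.
move=> sigma0 lip [_ /(_ x) step] aabar.
pose d := q x - x.
have -> : a *: q x + (1 - a) *: x = x + a *: d.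
  by rewrite /d scalerBr scalerBl scale1r addrA addrCA addrA addrAC.
have Ea := linearization_error R H g sigma x (a *: d) sigma0 lip.
have E1 := linearization_error R H g sigma x d sigma0 lip.
have dE : x + d = q x by rewrite /d addrC subrK.
rewrite dE in E1.
set ra := (X in `|X| <= _) in Ea; set r1 := (X in `|X| <= _) in E1.
(* By linearity of the differential, [ra] and [a *: r1] contain the same first-order term
   [a *: 'd g x d], which cancels. *)
have -> : g (x + a *: d) = mixed_residual g q a x + (ra - a *: r1).
  rewrite /mixed_residual /ra /r1 linearZ /= !scalerBr scalerBl scale1r.
  set u := g (x + _); set A := a *: g (q x); set B := a *: g x.
  set C := a *: 'd g x d.
  rewrite !opprB (addrA _ C) subrK.
  by rewrite [RHS]addrC -addrA (addrA (B - A)) subrK [B + _]addrC !subrK.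
apply: (le_trans (dual_normD _ _)); rewrite lerD2l.
apply: (le_trans (@ler_normB R (dual H) _ _)).
rewrite normrZ in Ea.
rewrite [X in _ + X <= _](@dual_normZ R H a r1).
have d2 : `|d| ^+ 2 <= kappa0 ^+ 2 * `|g x| ^+ 2.
  by rewrite -exprMn lerXn2r ?nnegrE// (le_trans _ step).
have abar0 : 0 <= abar by rewrite (le_trans _ aabar).
(* The term [abar ^+ 2] comes from [ra], whose increment is [a *: d]; the term [abar] comes from the
   factor [a] in front of [r1]. *)
rewrite (@le_trans _ _ (sigma * (abar ^+ 2 + abar) * `|d| ^+ 2))//; last first.
  by rewrite -[leRHS]mulrA ler_wpM2l// mulr_ge0// addr_ge0// exprn_ge0.
rewrite mulrDr mulrDl lerD//.
  rewrite (le_trans Ea)// exprMn mulrA ler_wpM2r ?exprn_ge0//.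
  by rewrite ler_wpM2l// lerXn2r// nnegrE.
by rewrite (mulrC sigma) -mulrA ler_pM ?dual_norm_ge0.
Qed.

Theorem theorem3p2 (R : realType) (sigma1 kappa0 kappa1 alphabar : R)
    (sigma1_gt0 : 0 < sigma1) (kappa0_gt0 : 0 < kappa0)
    (kappa1_gt0 : 0 < kappa1) (alphabar_gt0 : 0 < alphabar) :
  exists C : R,
  forall (H : completeNormedModType R) (ip : {dot H for idfun})
    (g : H -> dual H) (q : H -> H),
    hilbert_norm ip ->
    has_common_solution g q ->
    lipschitz_diff g sigma1 ->
    residual_controls_step g q kappa0 ->
    residual_bounded_by g q kappa1 ->
  forall (alpha : nat -> R) (x : nat -> H),
    ngmres0 g q alpha x ->
    (forall k : nat, `|alpha k.+1| + `|1 - alpha k.+1| <= alphabar) ->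
  forall k : nat,
    (g (x k) != 0 ->
       `|g (x k.+1)| <= theta0 g q (alpha k.+1) (x k) * `|g (x k)|
                        + C * `|g (x k)| ^+ 2) /\
    (g (q (x k)) != 0 ->
       `|g (x k.+1)| <= gamma0 g q (alpha k.+1) (x k) * kappa1 * `|g (x k)|
                        + C * `|g (x k)| ^+ 2).
Proof.
(* This constant is fixed before the space, the maps and the iterates, so the quadratic term is
   uniform in all of them and in [k]. *)
exists (sigma1 * (alphabar ^+ 2 + alphabar) * kappa0 ^+ 2).
move=> H ip g q _ _ lip step bnd alpha x gen alphaP k.
have [_ ->] := gen k.
have a_le : `|alpha k.+1| <= alphabar.
  by rewrite (le_trans _ (alphaP k))// lerDl.
have E := mixed_residual_error R H g q sigma1 kappa0 alphabar
  (alpha k.+1) (x k) (ltW sigma1_gt0) lip step a_le.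
split=> [gx0|gq0]; apply: (le_trans E); rewrite lerD2r.
  by rewrite /theta0 divfK ?normr_eq0.
(* Multiply and divide by the norm of [g (q (x k))], then bound that factor by [bnd]. *)
rewrite /gamma0 -mulrA -[leLHS](divfK (_ : `|g (q (x k))| != 0)) ?normr_eq0//.
by rewrite ler_wpM2l ?divr_ge0.
Qed.
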